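(* Let $R$ be a ring. (1) Let $k$ be a field. Then every $k$-algebra has property $( ** )$. In particular, every ring of prime characteristic $p > 0$ has property $( ** )$. (2) If the additive group $(R, +)$ is torsionfree, then $R$ has property $( ** )$. In particular, if $R$ is a domain, then $R$ has property $( ** )$.
   Context: All rings and algebras are commutative with $1 \neq 0$, and ring maps take $1$ to $1$. A ring $R$ has property $( ** )$ if there exist a Noetherian ring $S$ and a flat ring map $S \to R$ (i.e. $R$ is flat as an $S$-module). *)

(* Defs.v *)
From HB Require Import structures.
From mathcomp Require Import all_boot all_order all_algebra.
From mathcomp Require Import boolp classical_sets.
From mathcomp.multinomials Require Import freeg.

Set Implicit Arguments.
Unset Strict Implicit.
Unset Printing Implicit Defensive.

Import GRing.Theory.

Local Open Scope ring_scope.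
Local Open Scope classical_set_scope.
Local Open Scope quotient_scope.

Section Submodule.
Variables (S : comNzRingType) (V : lmodType S).
Implicit Types (I G : set V).

Definition is_submodule I : Prop :=
  I 0 /\ forall (a : S) (u v : V), I u -> I v -> I (a *: u + v).

Definition submodule_span G : set V :=
  [set x | forall I, is_submodule I -> G `<=` I -> I x].

Lemma submodule_span_is_submodule G : is_submodule (submodule_span G).
Proof.
split=> [I [] // | a u v Gu Gv I sI GI].
by case: (sI) => _; apply; [apply: Gu | apply: Gv].
Qed.

Lemma sub_submodule_span G : G `<=` submodule_span G.
Proof. by move=> x Gx I _; apply. Qed.

(* The same set as a boolean predicate, by excluded middle, so that the library
   quotient of a Z-module applies to it. *)
Definition span_pred G (x : V) : bool := `[< submodule_span G x >].

Lemma span_pred_closed G : submod_closed (span_pred G).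
Proof.
have [G0 GD] := submodule_span_is_submodule G.
split=> [|a u v]; first exact: asboolT.
by move=> /asboolW Gu /asboolW Gv; apply: asboolT; apply: GD.
Qed.

HB.instance Definition _ G :=
  GRing.isSubmodClosed.Build S V (span_pred G)
    (GRing.submod_closed_semi (span_pred_closed G)).

Definition quot_span G : Type :=
  Quotient.quot (GRing.ZmodClosed.clone V (span_pred G) _).

HB.instance Definition _ G := GRing.Zmodule.on (quot_span G).
HB.instance Definition _ G := Quotient.on (quot_span G).

Definition quot_proj G (x : V) : quot_span G := \pi_(quot_span G) x.

Lemma quot_projE G x y :
  (quot_proj G x == quot_proj G y) = ((x - y) \in span_pred G).
Proof. by rewrite /quot_proj -Quotient.idealrBE. Qed.

Lemma quot_proj_is_zmod_morphism G : zmod_morphism (quot_proj G).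
Proof. by move=> x y; rewrite /quot_proj !piE. Qed.

Definition quot_scale G (a : S) (x : quot_span G) : quot_span G :=
  quot_proj G (a *: repr x).

Lemma quot_scale_proj G a x :
  quot_scale a (quot_proj G x) = quot_proj G (a *: x).
Proof.
apply/eqP; rewrite quot_projE -scalerBr rpredZ // -quot_projE.
by rewrite /quot_proj reprK.
Qed.

Lemma quot_projK G (x : quot_span G) : quot_proj G (repr x) = x.
Proof. exact: reprK. Qed.

Fact quot_scaleA G a b (x : quot_span G) :
  quot_scale a (quot_scale b x) = quot_scale (a * b) x.
Proof. by rewrite -[x]quot_projK !quot_scale_proj scalerA. Qed.

Fact quot_scale1 G : left_id 1 (@quot_scale G).
Proof. by move=> x; rewrite -[x]quot_projK quot_scale_proj scale1r. Qed.

Fact quot_scaleDr G : right_distributive (@quot_scale G) +%R.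
Proof.
move=> a x y; rewrite -[x]quot_projK -[y]quot_projK !quot_scale_proj.
have projD u v : quot_proj G u + quot_proj G v = quot_proj G (u + v).
  by rewrite /quot_proj !piE.
by rewrite !projD quot_scale_proj scalerDr.
Qed.

Fact quot_scaleDl G (x : quot_span G) :
  {morph (@quot_scale G)^~ x : a b / a + b}.
Proof.
move=> a b; rewrite -[x]quot_projK !quot_scale_proj scalerDl.
by rewrite /quot_proj !piE.
Qed.

HB.instance Definition _ G := GRing.Zmodule_isLmodule.Build S (quot_span G)
  (@quot_scaleA G) (@quot_scale1 G) (@quot_scaleDr G) (@quot_scaleDl G).

HB.instance Definition _ G := GRing.isZmodMorphism.Build V (quot_span G)
  (quot_proj G) (@quot_proj_is_zmod_morphism G).

Fact quot_proj_is_scalable G : scalable (quot_proj G).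
Proof. by move=> a x; rewrite -quot_scale_proj. Qed.

HB.instance Definition _ G := GRing.isScalable.Build S V (quot_span G) *:%R
  (quot_proj G) (@quot_proj_is_scalable G).

End Submodule.

Section Tensor.
Variables (S : comNzRingType) (M N : lmodType S).

Let F : lmodType S := {freeg (M * N)%type / S}.

Definition tensor_gen (m : M) (n : N) : F := << (m, n) >>.

Definition tensor_rel : set F :=
  [set x | exists (a : S) (m m' : M) (n : N), x =
     tensor_gen (a *: m + m') n - (a *: tensor_gen m n + tensor_gen m' n)]
  `|`
  [set x | exists (a : S) (m : M) (n n' : N), x =
     tensor_gen m (a *: n + n') - (a *: tensor_gen m n + tensor_gen m n')].

Definition tensor : Type := quot_span tensor_rel.

HB.instance Definition _ := GRing.Lmodule.on tensor.

Definition pure_tensor (m : M) (n : N) : tensor :=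
  quot_proj tensor_rel (tensor_gen m n).

Fact pure_tensor_bilinear : bilinear_for *:%R *:%R pure_tensor.
Proof.
split=> [n a m m' | m a n n']; rewrite /pure_tensor;
  rewrite -linearP; apply/eqP; rewrite quot_projE; apply/asboolP;
  apply: sub_submodule_span.
  by left; exists a, m, m', n.
by right; exists a, m, n, n'.
Qed.

HB.instance Definition _ := bilinear_isBilinear.Build S M N tensor *:%R *:%R
  pure_tensor pure_tensor_bilinear.

(* Universal property: the linear map out of the tensor product determined by a
   bilinear map b. *)
Section Lift.
Variables (P : lmodType S) (b : {bilinear M -> N -> P}).

Let lift0 : F -> P := fglift (fun mn => b mn.1 mn.2).

Let lift0P : linear lift0.
Proof.
have addB : zmod_morphism lift0 := @lift_is_additive _ _ _ _.
have add0 : lift0 0 = 0 by rewrite -(subr0 0) addB subrr.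
have addD x y : lift0 (x + y) = lift0 x + lift0 y.
  rewrite -[y in LHS]opprK addB; congr (_ + _).
  by rewrite -[- y]add0r addB add0 add0r opprK.
have sum0 I (r : seq I) (E : I -> F) :
  lift0 (\sum_(i <- r) E i) = \sum_(i <- r) lift0 (E i).
  exact: (big_morph lift0 addD add0).
move=> a x y; rewrite addD; congr (_ + _).
rewrite -[x in RHS]freeg_sumE [a *: x]/(fgscale a x) /fgscale !sum0 scaler_sumr.
by apply: eq_bigr => i _; rewrite /lift0 !liftU scalerA.
Qed.

Definition tensor_lift (t : tensor) : P := lift0 (repr t).

Let tensor_lift_proj x : tensor_lift (quot_proj _ x) = lift0 x.
Proof.
pose K : set F := [set x | lift0 x = 0].
have K0 : lift0 0 = 0.
  by have := lift0P (-1) 0 0; rewrite !scaleN1r oppr0 addr0 addNr.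
have sK : is_submodule K.
  split=> [//| a u v Ku Kv]; rewrite /K /= lift0P.
  by rewrite (Ku : lift0 u = 0) (Kv : lift0 v = 0) scaler0 addr0.
have lD a u v w : lift0 (w - (a *: u + v)) = lift0 w - (a *: lift0 u + lift0 v).
  by rewrite -[w - _]addrC -scaleN1r lift0P lift0P scaleN1r addrC.
have lg m n : lift0 (tensor_gen m n) = b m n by rewrite /lift0 liftU scale1r.
have relK : tensor_rel `<=` K.
  move=> _ [[a [m [m' [n ->]]]] | [a [m [n [n' ->]]]]]; rewrite /K /= lD !lg.
    by rewrite linearPl subrr.
  by rewrite linearPr subrr.
have := quot_projK (quot_proj tensor_rel x) => /eqP.
rewrite quot_projE => /asboolP /(_ K sK relK) /=.
rewrite -[X in X - _]scale1r -[- x]addr0 /K /= -scaleN1r !lift0P K0 addr0.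
by rewrite scale1r scaleN1r => /subr0_eq.
Qed.

Fact tensor_lift_is_linear : linear tensor_lift.
Proof.
move=> a x y; rewrite -[x]quot_projK -[y]quot_projK -linearP !tensor_lift_proj.
exact: lift0P.
Qed.

HB.instance Definition _ := GRing.isLinear.Build S tensor P *:%R tensor_lift
  tensor_lift_is_linear.

Lemma tensor_lift_pure m n : tensor_lift (pure_tensor m n) = b m n.
Proof. by rewrite tensor_lift_proj /lift0 liftU scale1r. Qed.

End Lift.

Lemma tensor_sum (t : tensor) :
  exists s : seq (M * N), t = \sum_(x <- s) pure_tensor x.1 x.2.
Proof.
rewrite -[t]quot_projK -[repr t]freeg_sumE linear_sum /=.
exists [seq (coeff z (repr t) *: z.1, z.2) | z <- dom (repr t)].
rewrite [RHS]big_map; apply: eq_bigr => -[m n] _ /=.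
rewrite linearZl_LR /= /pure_tensor -linearZ; congr (quot_proj _ _).
by apply/eqP/freeg_eqP => y; rewrite coeffZ !coeffU mul1r.
Qed.

Lemma tensor_lift_uniq (P : lmodType S) (g h : {linear tensor -> P}) :
  (forall m n, g (pure_tensor m n) = h (pure_tensor m n)) -> g =1 h.
Proof.
move=> gh t; have [s ->] := tensor_sum t.
by rewrite !linear_sum; apply: eq_bigr => x _; apply: gh.
Qed.

End Tensor.

Section TensorMap.
Variables (S : comNzRingType) (M N N' : lmodType S) (u : {linear N -> N'}).

Definition tensor_map_fun (m : M) (n : N) : tensor M N' :=
  pure_tensor m (u n).

Fact tensor_map_fun_bilinear : bilinear_for *:%R *:%R tensor_map_fun.
Proof.
split=> [n a m m' | m a n n']; rewrite /tensor_map_fun.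
  by rewrite linearPl.
by rewrite linearP linearPr.
Qed.

HB.instance Definition _ := bilinear_isBilinear.Build S M N (tensor M N')
  *:%R *:%R tensor_map_fun tensor_map_fun_bilinear.

(* id_M (x) u *)
Definition tensor_map : tensor M N -> tensor M N' := tensor_lift tensor_map_fun.

HB.instance Definition _ := GRing.Linear.on tensor_map.

Lemma tensor_map_pure m n :
  tensor_map (pure_tensor m n) = pure_tensor m (u n).
Proof. exact: tensor_lift_pure. Qed.

End TensorMap.

Arguments tensor_map {S} M {N N'} u t.

Definition flat_module (S : comNzRingType) (M : lmodType S) : Prop :=
  forall (N N' : lmodType S) (u : {linear N -> N'}),
    injective u -> injective (tensor_map M u).

(* The target R of f, seen as an S-module by s *: x := f s * x. *)
Definition restr_scalars (S R : comNzRingType) (f : {rmorphism S -> R}) : Type :=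
  R.

Section RestrScalars.
Variables (S R : comNzRingType) (f : {rmorphism S -> R}).

HB.instance Definition _ := GRing.Zmodule.copy (restr_scalars f) R.

Definition restr_scale (s : S) (x : restr_scalars f) : restr_scalars f :=
  f s * (x : R).

Fact restr_scaleA a b x : restr_scale a (restr_scale b x) = restr_scale (a * b) x.
Proof. by rewrite /restr_scale rmorphM mulrA. Qed.

Fact restr_scale1 : left_id 1 restr_scale.
Proof. by move=> x; rewrite /restr_scale rmorph1 mul1r. Qed.

Fact restr_scaleDr : right_distributive restr_scale +%R.
Proof. by move=> a x y; rewrite /restr_scale mulrDr. Qed.

Fact restr_scaleDl x : {morph restr_scale^~ x : a b / a + b}.
Proof. by move=> a b; rewrite /restr_scale rmorphD mulrDl. Qed.

HB.instance Definition _ := GRing.Zmodule_isLmodule.Build S (restr_scalars f)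
  restr_scaleA restr_scale1 restr_scaleDr restr_scaleDl.

End RestrScalars.

Definition flat_morphism (S R : comNzRingType) (f : {rmorphism S -> R}) : Prop :=
  flat_module (restr_scalars f).

(* S^o is S as a module over itself, so its submodules are the ideals of S. *)
Definition noetherian (S : comNzRingType) : Prop :=
  forall I : set S^o, is_submodule I ->
    exists s : seq S^o, I = submodule_span [set` s].

Definition flat_over_noetherian (R : comNzRingType) : Prop :=
  exists (S : comNzRingType) (f : {rmorphism S -> R}),
    noetherian S /\ flat_morphism f.

Definition torsionfree (A : zmodType) : Prop :=
  forall (n : nat) (x : A), (0 < n)%N -> x *+ n = 0 -> x = 0.

(* Main.v *)
Require Import Defs.
From HB Require Import structures.
From mathcomp Require Import all_boot all_order all_algebra.
From mathcomp Require Import finfield ring.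
From mathcomp Require Import boolp classical_sets.
From mathcomp.multinomials Require Import freeg.

(** The base ring S can be taken to be a field or the ring of integers: both
are principal ideal domains, hence Noetherian, and over a principal ideal
domain every torsion-free module is flat. Every module over a field is
torsion-free; a ring of characteristic p is an algebra over the prime field; a
ring whose additive group is torsion-free is torsion-free over the integers;
and a domain is of one of these last two kinds.

Flatness of a torsion-free module M over a principal ideal domain has two
ingredients.

- Every finite family of M lies in the span of a linearly independent one
  ([independent_span]). As long as there is a nontrivial relation among n
  generators, a unimodular change of generators rewrites the relation as
  g y = 0 with g nonzero and y one of the new generators
  ([collect_lincomb]); then y = 0 by torsion-freeness, and n - 1 generators
  suffice.

- A module with this property is flat ([directed_union_free_flat]), because
  it is a directed union of free modules. The proof does not form the free
  submodules or the colimit. A proof that a tensor of M (x) N' is zero involves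
  finitely many elements of M; once an independent family e spans them, the
  coordinates along e turn the vanishing of the tensor into equations in N'
  ([tensor_eq0_coord]). An injective map N -> N' pulls these equations back to
  N, where they show that the tensor of M (x) N is zero. *)

Set Implicit Arguments.
Unset Strict Implicit.
Unset Printing Implicit Defensive.

Import Order.TTheory GRing.Theory Num.Theory.

Local Open Scope ring_scope.
Local Open Scope classical_set_scope.

(** * Linear combinations and spans of finite families *)

Definition lincomb (S : nzRingType) (V : lmodType S) (c : nat -> S)
    (e : seq V) : V :=
  \sum_(i < size e) c i *: e`_i.

Definition independent (S : nzRingType) (V : lmodType S) (e : seq V) : Prop :=
  forall c : nat -> S, lincomb c e = 0 -> forall i, (i < size e)%N -> c i = 0.

Local Notation seq_span s := (submodule_span [set` s]).

Section Combinations.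
Variables (S : comNzRingType) (V : lmodType S).
Implicit Types (c : nat -> S) (e s : seq V).

Lemma lincomb_nil c : lincomb c ([::] : seq V) = 0.
Proof. by rewrite /lincomb big_ord0. Qed.

Lemma lincomb_cons c x e :
  lincomb c (x :: e) = c 0%N *: x + lincomb (c \o succn) e.
Proof. by rewrite /lincomb big_ord_recl. Qed.

Lemma lincombP a c d e :
  lincomb (fun i => a * c i + d i) e = a *: lincomb c e + lincomb d e.
Proof.
rewrite /lincomb scaler_sumr -big_split; apply: eq_bigr => i _ /=.
by rewrite scalerDl scalerA.
Qed.

Lemma lincomb_sub (I : set V) c e :
  is_submodule I -> [set` e] `<=` I -> I (lincomb c e).
Proof.
move=> [I0 ID]; elim: e c => [|x e IHe] c eI; first by rewrite lincomb_nil.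
rewrite lincomb_cons; apply: ID; first by apply: eI; rewrite /= mem_head.
by apply: IHe => y /= ye; apply: eI; rewrite /= in_cons ye orbT.
Qed.

Lemma submodule_span_min (G I : set V) :
  is_submodule I -> G `<=` I -> submodule_span G `<=` I.
Proof. by move=> sI GI x; apply. Qed.

Lemma span_lincomb s x : seq_span s x <-> exists c, x = lincomb c s.
Proof.
split=> [|[c ->]]; last first.
  apply: lincomb_sub; first exact: submodule_span_is_submodule.
  exact: sub_submodule_span.
move: x; apply: (@submodule_span_min _ [set x | exists c, x = lincomb c s]).
  split.
    by exists (fun=> 0); rewrite /lincomb big1 // => i _; rewrite scale0r.
  by move=> a _ _ [c ->] [d ->]; exists (fun i => a * c i + d i);
     rewrite lincombP.
move=> y /= ys; exists (fun i => (i == index y s)%:R).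
have yi : (index y s < size s)%N by rewrite index_mem.
rewrite /lincomb (bigD1 (Ordinal yi)) //= eqxx scale1r nth_index //.
rewrite big1 ?addr0 // => i.
by rewrite -val_eqE /= => /negPf->; rewrite scale0r.
Qed.

Lemma span_trans (G : set V) s : G `<=` seq_span s -> submodule_span G `<=` seq_span s.
Proof. by apply: submodule_span_min; apply: submodule_span_is_submodule. Qed.

Lemma mem_span s x : x \in s -> seq_span s x.
Proof. by move=> xs; apply: sub_submodule_span. Qed.

Lemma span1 (x y : V) : seq_span [:: x] y <-> exists a, y = a *: x.
Proof.
split=> [/span_lincomb[c ->]|[a ->]].
  by exists (c 0%N); rewrite lincomb_cons lincomb_nil addr0.
apply/span_lincomb; exists (fun=> a).
by rewrite lincomb_cons lincomb_nil addr0.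
Qed.

End Combinations.

(** * Torsion-free modules over a principal ideal domain *)

Definition principal_ideals (S : comNzRingType) : Prop :=
  forall I : set S^o, is_submodule I -> exists d : S^o, I = seq_span [:: d].

Lemma principal_noetherian S : principal_ideals S -> noetherian S.
Proof. by move=> pid I /pid[d ->]; exists [:: d]. Qed.

Section Pid.
Variables (S : idomainType) (pid : principal_ideals S).

(** The cofactors a' and b' are coprime even when a = b = 0, so that the matrix
with rows (a', b') and (-v, u) has determinant 1. *)
Lemma bezout (a b : S) :
  exists g a' b' u v : S, [/\ a = g * a', b = g * b' & u * a' + v * b' = 1].
Proof.
have [g] := pid (submodule_span_is_submodule [set` [:: a : S^o; b : S^o]]).
move=> abg; have in_g x : x \in [:: a; b] -> exists c, x = g * c.
  move=> xab; have: seq_span [:: a : S^o; b : S^o] x by apply: mem_span.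
  by rewrite abg => /span1[c ->]; exists c; rewrite mulrC.
have [a' aE] : exists c, a = g * c by apply: in_g; rewrite mem_head.
have [b' bE] : exists c, b = g * c by apply: in_g; rewrite !inE eqxx orbT.
have : seq_span [:: g] g by apply: mem_span; rewrite mem_head.
rewrite -abg => /span_lincomb[c].
rewrite !lincomb_cons lincomb_nil addr0 /= /GRing.scale /= => gE.
have [g0|g0] := eqVneq g 0.
  exists 0, 1, 0, 1, 0; rewrite aE bE g0.
  by split; rewrite ?(mul0r, mulr1, addr0).
exists g, a', b', (c 0%N), (c 1%N); split=> //; apply: (mulfI g0).
by rewrite mulr1 [RHS]gE aE bE; ring.
Qed.

Variable V : lmodType S.

(** One Bezout step replaces two generators x and y1 by y and w through a matrix
of determinant 1 and merges their two terms into a multiple of y; the span and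
the number of generators do not change. *)
Lemma collect_lincomb (c : nat -> S) (x : V) (s : seq V) :
  exists (g : S) (y : V) (z : seq V),
  [/\ size z = size s, lincomb c (x :: s) = g *: y,
      [set` x :: s] `<=` seq_span (y :: z)
    & g = 0 -> forall i, (i <= size s)%N -> c i = 0].
Proof.
elim: s x c => [|x1 s IHs] x c.
  exists (c 0%N), x, [::]; split=> //.
  - by rewrite lincomb_cons lincomb_nil addr0.
  - exact: sub_submodule_span.
  - by move=> c0 i; rewrite leqn0 => /eqP->.
have [g1 [y1 [z [sz sum1 sub1 c1]]]] := IHs x1 (c \o succn).
have [g [a' [b' [u [v [aE bE uv1]]]]]] := bezout (c 0%N) g1.
set y := a' *: x + b' *: y1; set w := u *: y1 - v *: x.
have xE : x = u *: y - b' *: w.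
  rewrite -[LHS]scale1r -uv1 /y /w.
  rewrite !(scalerBr, scalerDr, scalerN, scalerA, scalerDl).
  by rewrite (mulrC b' u) (mulrC b' v) opprB [RHS]addrACA subrr addr0.
have y1E : y1 = v *: y + a' *: w.
  rewrite -[LHS]scale1r -uv1 /y /w.
  rewrite !(scalerBr, scalerDr, scalerN, scalerA, scalerDl).
  by rewrite (mulrC v a') (mulrC u a') [RHS]addrC addrA subrK.
exists g, y, (w :: z); split.
- by rewrite /= sz.
- by rewrite lincomb_cons sum1 aE bE /y scalerDr !scalerA.
- have [sp0 spP] := submodule_span_is_submodule [set` [:: y, w & z]].
  have spy : seq_span [:: y, w & z] y.
    by apply: mem_span; rewrite mem_head.
  have spw : seq_span [:: y, w & z] w.
    by apply: mem_span; rewrite !inE eqxx orbT.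
  have spZ a p : seq_span [:: y, w & z] p -> seq_span [:: y, w & z] (a *: p).
    by move=> sp; rewrite -[_ *: _]addr0; apply: spP.
  move=> t /=; rewrite in_cons => /predU1P[->|ts].
    by rewrite xE -scaleNr; apply: spP => //; apply: spZ.
  apply: span_trans (sub1 _ ts) => r /=; rewrite in_cons => /predU1P[->|rz].
    by rewrite y1E; apply: spP => //; apply: spZ.
  by apply: mem_span; rewrite !in_cons rz !orbT.
- move=> g0 [|i] lei; first by rewrite aE g0 mul0r.
  by apply: (c1 _ i) => //; rewrite bE g0 mul0r.
Qed.

Hypothesis torsion0 : forall (a : S) (x : V), a *: x = 0 -> a = 0 \/ x = 0.

(** By induction on the number of generators: after a change of generators, a
nontrivial relation says that one of them is 0, and it can be dropped. *)
Lemma independent_span (s : seq V) :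
  exists e, independent e /\ [set` s] `<=` seq_span e.
Proof.
have [n] := ubnP (size s); elim: n s => // n IHn [|x s] sn.
  by exists [::]; split.
have [|/existsNP[c /not_implyP[c0 nz]]] := pselect (independent (x :: s)).
  by exists (x :: s); split=> //; apply: sub_submodule_span.
have [g [y [z [sz yE sub g0]]]] := collect_lincomb c x s.
have [|e [inde ze]] := IHn z; first by rewrite sz.
exists e; split=> // t /sub; apply: span_trans => r /=.
rewrite in_cons => /predU1P[->|]; last exact: ze.
(* g = 0 would make the coefficients c vanish: the relation is nontrivial. *)
have [/g0 ci0|->] := torsion0 (etrans (esym yE) c0).
  by case: nz => i; apply: ci0.
by case: (submodule_span_is_submodule [set` e]).
Qed.

End Pid.

(** * Coordinates along an independent family *)

Section Coordinates.
Variables (S : comNzRingType) (V : lmodType S).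
Implicit Types e : seq V.

(** The default value 0 outside of the span of [e] makes [coord e] total, but
linearity can be expected on that span only. *)
Definition coord e (x : V) : nat -> S :=
  if pselect (exists c, x = lincomb c e) is left h then projT1 (cid h)
  else fun=> 0.

Lemma coordK e x : seq_span e x -> lincomb (coord e x) e = x.
Proof.
move=> /span_lincomb ex; rewrite /coord; case: pselect => // h.
by case: (cid h) => c /= ->.
Qed.

Lemma coordP e a x y i : independent e -> (i < size e)%N ->
  seq_span e x -> seq_span e y -> coord e (a *: x + y) i = a * coord e x i + coord e y i.
Proof.
move=> inde ie ex ey; have [_ eP] := submodule_span_is_submodule [set` e].
apply/eqP; rewrite eq_sym -subr_eq0 -mulN1r addrC; apply/eqP.
pose d i := a * coord e x i + coord e y i.
apply: (inde (fun i => -1 * coord e (a *: x + y) i + d i)) => //.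
rewrite lincombP lincombP !coordK //; last exact: eP.
by rewrite scaleN1r addNr.
Qed.

End Coordinates.

(** * Linear maps out of a free module *)

Section Fglift.
Variables (S : comNzRingType) (T : choiceType) (P : lmodType S) (h : T -> P).

HB.instance Definition _ := GRing.isZmodMorphism.Build {freeg T / S} P (fglift h)
  (lift_is_additive h).

Lemma fglift_scalable : scalable (fglift h).
Proof.
move=> a x; rewrite -[x in RHS]freeg_sumE [a *: x]/(fgscale a x) /fgscale.
rewrite [LHS](raddf_sum (fglift h)) [in RHS](raddf_sum (fglift h)) /= scaler_sumr.
by apply: eq_bigr => z _; rewrite !liftU scalerA.
Qed.

HB.instance Definition _ := GRing.isScalable.Build S {freeg T / S} P *:%R
  (fglift h) fglift_scalable.

End Fglift.

(** * Flatness of directed unions of free modules *)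

(** An elementwise form of being the directed union of the finitely generated free
submodules. *)
Definition directed_union_free (S : comNzRingType) (M : lmodType S) : Prop :=
  forall s : seq M, exists e, independent e /\ [set` s] `<=` seq_span e.

Section DirectedUnion.
Variables (S : comNzRingType) (M : lmodType S).

(** When m lies in the span of an independent [e], m (x) n is the sum of the
e_i (x) (m_i n); [contract e i] extracts m_i n. It is defined on formal sums,
not on tensors, since [coord e] need not be linear on the whole of M. *)
Definition contract (N : lmodType S) (e : seq M) (i : nat) :
    {freeg (M * N)%type / S} -> N :=
  fglift (fun mn => coord e mn.1 i *: mn.2).

HB.instance Definition _ (N : lmodType S) e i := GRing.Linear.on (@contract N e i).

(** The formal sums all of whose contractions vanish along every independent family
with a large enough span. A large span is what makes [coord e] linear on the
elements at hand, and it lets these formal sums contain the tensor relations. *)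
Definition eventually0 (N : lmodType S) : set {freeg (M * N)%type / S} :=
  [set x | exists s : seq M, forall e i, independent e -> [set` s] `<=` seq_span e ->
     (i < size e)%N -> contract e i x = 0].

Lemma contract_gen (N : lmodType S) e i m (n : N) :
  contract e i (tensor_gen m n) = coord e m i *: n.
Proof. by rewrite /contract liftU scale1r. Qed.

Lemma eventually0_submodule (N : lmodType S) : is_submodule (@eventually0 N).
Proof.
split=> [|a x y [s1 x0] [s2 y0]].
  by exists [::] => e i _ _ _; rewrite linear0.
exists (s1 ++ s2) => e i inde se ie; rewrite linearP /= x0 ?y0 ?scaler0 ?addr0 //.
  by move=> t t2; apply: se; rewrite /= mem_cat t2 orbT.
by move=> t t1; apply: se; rewrite /= mem_cat t1.
Qed.

Lemma tensor_rel_eventually0 (N : lmodType S) :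
  @tensor_rel S M N `<=` @eventually0 N.
Proof.
move=> _ [[a [m [m' [n ->]]]] | [a [m [n [n' ->]]]]].
  exists [:: m; m'] => e i inde se ie; rewrite linearB linearP /= !contract_gen.
  rewrite coordP ?scalerDl ?scalerA ?subrr //.
    by apply: se; rewrite /= mem_head.
  by apply: se; rewrite /= !inE eqxx orbT.
exists [::] => e i _ _ _; rewrite linearB linearP /= !contract_gen.
by rewrite scalerDr !scalerA (mulrC a) subrr.
Qed.

Hypothesis M_union : directed_union_free M.

(** The formal sum of a zero tensor is generated by the tensor relations, so its
contractions eventually vanish; the hypothesis on M supplies an independent family
that is large enough. *)
Lemma tensor_eq0_coord (N : lmodType S) (s : seq (M * N)) :
  \sum_(x <- s) pure_tensor x.1 x.2 = 0 ->
  exists e, [set` map fst s] `<=` seq_span e /\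
    forall i, (i < size e)%N -> \sum_(x <- s) coord e x.1 i *: x.2 = 0.
Proof.
move=> s0; pose rel := @tensor_rel S M N.
have /eqP : quot_proj rel (\sum_(x <- s) tensor_gen x.1 x.2) = quot_proj rel 0.
  by rewrite linear_sum linear0.
rewrite quot_projE subr0 => /asboolP.
move=> /(_ _ (@eventually0_submodule N) (@tensor_rel_eventually0 N)) [t t0].
have [e [inde te]] := M_union (t ++ map fst s).
exists e; split=> [m ms|i ie].
  by apply: te; rewrite /= mem_cat (ms : m \in map fst s) orbT.
rewrite -[RHS](t0 e i) // => [|m mt]; last by apply: te; rewrite /= mem_cat mt.
by rewrite linear_sum; apply: eq_bigr => x _ /=; rewrite contract_gen.
Qed.

(** Expanding the elements of M along e writes the tensor as the sum of the
e_i (x) n_i, where n_i is its i-th contraction. The n_i are zero because u is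
injective and kills them. *)
Lemma directed_union_free_flat : flat_module M.
Proof.
move=> N N' u u_inj; apply: raddf_inj => t.
have [s ->] := tensor_sum t; rewrite raddf_sum => s0.
have /tensor_eq0_coord[e [se ze]] :
    \sum_(y <- [seq (x.1, u x.2) | x <- s]) pure_tensor y.1 y.2 = 0.
  rewrite -[RHS]s0 big_map; apply: eq_bigr => x _ /=.
  by rewrite tensor_map_pure.
have sE x : x \in s -> x.1 = lincomb (coord e x.1) e.
  move=> xs; rewrite coordK //; apply: se => /=; rewrite -map_comp.
  by apply/mapP; exists x.
have {ze} ze i : (i < size e)%N -> \sum_(x <- s) coord e x.1 i *: x.2 = 0.
  move=> /ze; rewrite big_map => z0; apply: u_inj.
  by rewrite raddf0 -[RHS]z0 raddf_sum; apply: eq_bigr => x _ /=;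
     rewrite linearZ_LR.
transitivity (\sum_(x <- s) \sum_(i < size e)
    pure_tensor e`_i (coord e x.1 i *: x.2)).
  apply: eq_big_seq => x /sE {1}->; rewrite linear_sumlz.
  by apply: eq_bigr => i _; rewrite linearZl_LR linearZr_LR.
rewrite exchange_big big1 // => i _.
by rewrite -linear_sumr ze ?linear0r.
Qed.

End DirectedUnion.

(** * The base rings *)

Lemma pid_flat_over_noetherian (S : idomainType) (R : comNzRingType)
    (f : {rmorphism S -> R}) :
  principal_ideals S ->
  (forall (a : S) (x : R), f a * x = 0 -> a = 0 \/ x = 0) ->
  flat_over_noetherian R.
Proof.
move=> pid tors; exists S, f; split; first exact: principal_noetherian.
by apply: directed_union_free_flat; apply: independent_span.
Qed.

Lemma field_principal (k : fieldType) : principal_ideals k.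
Proof.
move=> I sI; have [I0 IP] := sI.
have [[x Ix x0]|nI] := pselect (exists2 x, I x & x != 0).
  exists x; rewrite eqEsubset; split=> y.
    by move=> _; apply/span1; exists (y / x); rewrite /GRing.scale /= divfK.
  by move: y; apply: submodule_span_min => // _ /= /[!inE] /eqP->.
exists 0; rewrite eqEsubset; split=> y.
  move=> Iy; have -> : y = 0.
    by apply: contra_notP nI => /eqP y0; exists y.
  by apply: mem_span; rewrite mem_head.
by move: y; apply: submodule_span_min => // _ /= /[!inE] /eqP->.
Qed.

Lemma field_flat_over_noetherian (k : fieldType) (R : comNzRingType)
  (f : {rmorphism k -> R}) : flat_over_noetherian R.
Proof.
apply: (@pid_flat_over_noetherian k R f); first exact: field_principal.
move=> a x fax; have [->|a0] := eqVneq a 0; [by left | right].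
by rewrite -[x]mul1r -(rmorph1 f) -(mulVf a0) rmorphM -mulrA fax mulr0.
Qed.

Lemma pchar_flat_over_noetherian (R : comNzRingType) p :
  p \in [pchar R] -> flat_over_noetherian R.
Proof.
move=> pR; have f : {rmorphism 'F_p -> pPrimeCharType pR}.
  exact: GRing.in_alg.
exact: (@field_flat_over_noetherian 'F_p R f).
Qed.

Lemma int_principal : principal_ideals int.
Proof.
move=> I sI; have [I0 IP] := sI.
have IM a x : I x -> I (a * x) by move=> Ix; rewrite -[_ * _]addr0; apply: IP.
have [exn|nI] := pselect (exists n : nat, `[< (0 < n)%N /\ I n%:Z >]); last first.
  exists 0; rewrite eqEsubset; split=> y; last first.
    by move: y; apply: submodule_span_min => // _ /= /[!inE] /eqP->.
  move=> Iy; have -> : y = 0.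
    apply: contra_notP nI => /eqP y0; exists `|y|%N; apply/asboolP.
    rewrite absz_gt0; split=> //; rewrite abszE.
    by rewrite normrEsg; apply: IM.
  by apply: mem_span; rewrite mem_head.
(* The least positive element of the ideal generates it. *)
case: (ex_minnP exn) => n /asboolP[n_gt0 In] n_min.
exists n%:Z; rewrite eqEsubset; split=> y; last first.
  by move: y; apply: submodule_span_min => // _ /= /[!inE] /eqP->.
move=> Iy; apply/span1; exists (y %/ n)%Z; rewrite /GRing.scale /=.
rewrite {1}(divz_eq y n); suff -> : (y %% n)%Z = 0 by rewrite addr0.
have r_ge0 : 0 <= (y %% n)%Z by apply: modz_ge0; rewrite -lt0n.
have r_lt : (y %% n)%Z < n by apply: ltz_pmod.
have Ir : I (y %% n)%Z.
  by rewrite /modz addrC -mulNr; apply: IP.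
apply: contraTeq r_lt => r0; rewrite -leNgt.
have := n_min `|(y %% n)%Z|%N; rewrite absz_gt0 r0 gez0_abs // => h.
by rewrite -[X in _ <= X]gez0_abs // lez_nat; apply: h; apply/asboolP.
Qed.

Lemma torsionfree_flat_over_noetherian (R : comNzRingType) :
  torsionfree R -> flat_over_noetherian R.
Proof.
move=> tf; apply: (@pid_flat_over_noetherian int R (intmul 1)).
  exact: int_principal.
move=> a x; rewrite mulrzl => ax; have [->|a0] := eqVneq a 0; [by left | right].
apply: (tf `|a|%N); first by rewrite absz_gt0.
case: a ax {a0} => n //; rewrite NegzE mulrNz => /eqP.
by rewrite oppr_eq0 => /eqP.
Qed.

(** If some n > 0 is 0 in R, then the least such n is prime: a proper factorization
of n would make one of its factors 0 in R. *)
Lemma domain_pchar_or_torsionfree (R : comNzRingType) :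
  GRing.integral_domain_axiom R ->
  (exists p, p \in [pchar R]) \/ torsionfree R.
Proof.
move=> dom; have [|npchar] := pselect (exists p, p \in [pchar R]); first by left.
right=> n x n_gt0; rewrite -mulr_natl => /dom /orP[n0|/eqP//].
case: npchar; have exn : exists n, (0 < n)%N && (n%:R == 0 :> R).
  by exists n; rewrite n_gt0.
case: (ex_minnP exn) => p /andP[p_gt0 p0] p_min; exists p.
rewrite inE p0 andbT; case: p p_gt0 p0 p_min => [|[|p]] // _.
  by rewrite oner_eq0.
set q := p.+2 => q0 q_min; have q_pr : prime (pdiv q) by apply: pdiv_prime.
have /dvdnP[d qE] := pdiv_dvd q.
have d_gt0 : (0 < d)%N by rewrite lt0n; apply: contra_eqN qE => /eqP->.
have := q0; rewrite {1}qE natrM => /eqP/dom/orP[d0|e0].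
  have: (q <= d)%N by apply: q_min; rewrite d_gt0.
  by rewrite leqNgt {1}qE ltn_Pmulr ?prime_gt1.
suff <- : pdiv q = q by [].
by apply/eqP; rewrite eqn_leq dvdn_leq ?pdiv_dvd // q_min // prime_gt0.
Qed.

Theorem proposition6 (R : comNzRingType) :
  ((forall (k : fieldType) (A : comAlgType k), flat_over_noetherian A) /\
   (forall p : nat, p \in [pchar R] -> flat_over_noetherian R)) /\
  ((torsionfree R -> flat_over_noetherian R) /\
   (GRing.integral_domain_axiom R -> flat_over_noetherian R)).
Proof.
split; split.
- by move=> k A; apply: (field_flat_over_noetherian (GRing.in_alg A)).
- exact: pchar_flat_over_noetherian.
- exact: torsionfree_flat_over_noetherian.
- move=> /domain_pchar_or_torsionfree[[p]|].
  + exact: pchar_flat_over_noetherian.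
  + exact: torsionfree_flat_over_noetherian.
Qed.
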